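(* Let $1\le p\le 2$, let $X$ be a complex Banach space of type $p$, and let $T$ be an absolutely Cesàro bounded operator on $X$. Then $\|T^n\|=O(n^{1/p})$ as $n\to\infty$. Moreover, there exists $C>0$ such that for every $x\in X$, every sequence $(\varepsilon_n)_{n\ge 0}$ of iid Rademacher variables and every $n\in\mathbb{N}$, $$\mathbb{E}\Big(\Big\|\sum_{k=0}^{n-1}\varepsilon_k T^k x\Big\|^p\Big)\le C\, n\,\|x\|^p .$$ If in addition $X$ is of finite cotype $q$ with $2\le q<\infty$, then $\|T^n\|=O\big(n^{1/p}/(\log n)^{1/q}\big)$ as $n\to\infty$, and there exists $\tilde C>0$ such that for every $x\in X$ and every $n\in\mathbb{N}$, $$\sum_{k=0}^{n-1}\|T^k x\|^q\le \tilde C\, n^{q/p}\,\|x\|^q .$$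
   Context: Rademacher variables are random variables taking the values $1$ and $-1$ with probability $1/2$ each; $\mathbb{E}$ denotes expectation; $\mathbb{N}=\{1,2,\dots\}$. A Banach space $X$ is of type $p\in[1,2]$ if there is $K>0$ such that for all $n\in\mathbb{N}$ and $x_1,\dots,x_n\in X$, $\mathbb{E}(\|\varepsilon_1x_1+\dots+\varepsilon_nx_n\|^p)\le K(\|x_1\|^p+\dots+\|x_n\|^p)$, where $\varepsilon_1,\dots,\varepsilon_n$ are iid Rademacher variables. $X$ is of finite cotype $q\in[2,\infty)$ if there is $K>0$ such that for all $n\in\mathbb{N}$ and $x_1,\dots,x_n\in X$, $\|x_1\|^q+\dots+\|x_n\|^q\le K\,\mathbb{E}(\|\varepsilon_1x_1+\dots+\varepsilon_nx_n\|^q)$. A bounded linear operator $T$ on $X$ is absolutely Cesàro bounded if there is $C>0$ such that $\sup_{n\ge1}\frac1n\sum_{k=0}^{n-1}\|T^kx\|\le C\|x\|$ for all $x\in X$. *)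

(* Defs.v *)
From HB Require Import structures.
From mathcomp Require Import all_boot all_order all_algebra.
From mathcomp Require Export complex.
From mathcomp Require Import all_classical all_reals all_analysis.

Set Implicit Arguments.
Unset Strict Implicit.
Unset Printing Implicit Defensive.

Import Order.TTheory GRing.Theory Num.Theory.
Import numFieldNormedType.Exports.

Local Open Scope classical_set_scope.
Local Open Scope complex_scope.
Local Open Scope ring_scope.

(* In a normed module over R[i] the norm `|x| is an element of R[i], real and
   nonnegative; rnorm x is the same number seen in R. *)
Definition rnorm (R : realType) (X : normedModType R[i]) (x : X) : R :=
  complex.Re `|x|.

Definition bounded_operator (R : realType) (X : normedModType R[i])
    (T : X -> X) : Prop :=
  exists M : R, forall x, rnorm (T x) <= M * rnorm x.

(* sup is the real supremum, with value 0 on an unbounded set: only meaningful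
   for bounded operators. *)
Definition opnorm (R : realType) (X : normedModType R[i]) (T : X -> X) : R :=
  sup [set rnorm (T x) | x in [set x | rnorm x <= 1]].

Definition absolutely_Cesaro_bounded (R : realType) (X : normedModType R[i])
    (T : X -> X) : Prop :=
  exists2 C : R, 0 < C & forall x : X,
    (ereal_sup [set (n%:R^-1 * \sum_(k < n) rnorm (iter k T x))%R%:E
               | n in [set n | (0 < n)%N]] <= (C * rnorm x)%R%:E)%E.

Definition rademacher (d : measure_display) (Omega : measurableType d)
    (R : realType) (P : probability Omega R) (e : {RV P >-> R}) : Prop :=
  P [set w | e w = 1] = (2^-1)%:E /\ P [set w | e w = -1] = (2^-1)%:E.

(* Mutual independence: the product rule for every finite subfamily. *)
Definition independent_RVs (d : measure_display) (Omega : measurableType d)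
    (R : realType) (P : probability Omega R) (I : eqType)
    (e : I -> {RV P >-> R}) : Prop :=
  forall (s : seq I) (A : I -> set R), uniq s ->
    (forall i, measurable (A i)) ->
    P [set w | forall i, i \in s -> A i (e i w)] =
    (\prod_(i <- s) P (e i @^-1` A i))%E.

Definition iid_rademacher (d : measure_display) (Omega : measurableType d)
    (R : realType) (P : probability Omega R) (I : eqType)
    (e : I -> {RV P >-> R}) : Prop :=
  (forall i, rademacher (e i)) /\ independent_RVs e.

(* The expectations below depend only on the joint law of the signs, hence the
   quantification over all probability spaces carrying them. *)
Definition of_type (R : realType) (X : normedModType R[i]) (p : R) : Prop :=
  exists2 K : R, 0 < K &
    forall (n : nat) (x : 'I_n -> X), (0 < n)%N ->
    forall (d : measure_display) (Omega : measurableType d)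
      (P : probability Omega R) (e : 'I_n -> {RV P >-> R}),
    iid_rademacher e ->
    ('E_P[fun w => (rnorm (\sum_(i < n) (e i w)%:C *: x i) `^ p)%R] <=
     (K * \sum_(i < n) rnorm (x i) `^ p)%R%:E)%E.

Definition of_cotype (R : realType) (X : normedModType R[i]) (q : R) : Prop :=
  exists2 K : R, 0 < K &
    forall (n : nat) (x : 'I_n -> X), (0 < n)%N ->
    forall (d : measure_display) (Omega : measurableType d)
      (P : probability Omega R) (e : 'I_n -> {RV P >-> R}),
    iid_rademacher e ->
    ((\sum_(i < n) rnorm (x i) `^ q)%R%:E <=
     K%:E * 'E_P[fun w => (rnorm (\sum_(i < n) (e i w)%:C *: x i) `^ q)%R])%E.

(* Main.v *)
(* The second estimate is the core.  With y = sum_{j<n} eps_j T^j x / |T^j x|,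
   type p gives E|y| <= c n^(1/p).  Applying absolute Cesaro boundedness to y,
   averaging, and reindexing the signs of T^k y so that the same eps_i always
   multiplies T^i x, one bounds E|sum_{i<n} eps_i b_i T^i x| by c n^(1+1/p),
   where b_i = sum_{j<=i} 1/|T^j x| >= (i+1)/(C |x|).  By contraction this
   controls the indices i >= n/2, and halving n repeatedly controls all of them:
   E|sum_{i<n} eps_i T^i x| <= A n^(1/p) |x|.  Kahane's inequality turns this
   first moment into any other one.  A single term is at most the mean, which
   gives |T^n| = O(n^(1/p)).

   For the logarithm, cut the sum at the scales 2^l <= n - i < 2^(l+1).  Cesaro
   boundedness applied to each block sum z_l gives E|z_l| >= |T^n x|/(2C), and
   cotype q applied to the blocks sums these log n lower bounds. *)

Require Import Defs.
From HB Require Import structures.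
From mathcomp Require Import all_boot all_order all_algebra.
From mathcomp Require Import complex.
From mathcomp Require Import all_classical all_reals all_analysis.
From mathcomp Require Import ring lra.

Import Order.TTheory GRing.Theory Num.Theory.
Import numFieldNormedType.Exports.

Local Open Scope classical_set_scope.
Local Open Scope complex_scope.
Local Open Scope ring_scope.

Set Implicit Arguments.
Unset Strict Implicit.

(** * Means over signs *)

Definition signed_sum (V : zmodType) (n : nat) (x : nat -> V)
    (w : {ffun 'I_n -> bool}) : V :=
  \sum_(i < n) (if w i then x i else - x i).

(** The expectation of [f] at a Rademacher sum, as a finite average over the cube. All estimates are
    proved for it; probability spaces enter only through type, cotype and the final statement.
    Sequences are indexed by [nat] so that the length can vary freely. *)
Definition rmean (R : realType) (V : zmodType) (n : nat) (x : nat -> V)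
    (f : V -> R) : R :=
  2^-1 ^+ n * \sum_(w : {ffun 'I_n -> bool}) f (signed_sum x w).

Section rmean_theory.
Context {R : realType} {V : zmodType}.
Implicit Types (n : nat) (x u v : nat -> V) (f g h : V -> R).

Lemma rmean0 x f : rmean 0 x f = f 0.
Proof.
rewrite /rmean expr0 mul1r (eq_bigr (fun=> f 0)); last first.
  by move=> w _; rewrite /signed_sum big_ord0.
by rewrite sumr_const card_ffun card_ord expn0.
Qed.

(** Conditioning on the last sign: a sign vector of length [n.+1] is its last sign together with the
    remaining vector. Inductions on the length rest on this. *)
Lemma rmeanS n x f :
  rmean n.+1 x f =
  2^-1 * (rmean n x (fun y => f (y + x n)) + rmean n x (fun y => f (y - x n))).
Proof.
rewrite /rmean -mulrDr mulrA -exprS; congr (_ * _).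
pose ext (p : bool * {ffun 'I_n -> bool}) : {ffun 'I_n.+1 -> bool} :=
  [ffun i => if unlift ord_max i is Some j then p.2 j else p.1].
pose res (w : {ffun 'I_n.+1 -> bool}) : bool * {ffun 'I_n -> bool} :=
  (w ord_max, [ffun j => w (lift ord_max j)]).
have extK : cancel ext res.
  move=> [b w]; rewrite /ext /res ffunE unlift_none; congr pair.
  by apply/ffunP => j; rewrite !ffunE liftK.
have resK : cancel res ext.
  move=> w; apply/ffunP => i; rewrite !ffunE.
  by case: unliftP => [j ->|->] //=; rewrite ffunE.
have extE p : signed_sum x (ext p) =
    signed_sum x p.2 + (if p.1 then x n else - x n).
  rewrite /signed_sum big_ord_recr /=; congr (_ + _).
    apply: eq_bigr => i _; rewrite ffunE.
    suff -> : widen_ord (leqnSn n) i = lift ord_max i by rewrite liftK.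
    by apply: val_inj; rewrite /= /bump leqNgt ltn_ord.
  by rewrite ffunE unlift_none.
rewrite (reindex ext) /=; last by exists res => w _; [exact: extK|exact: resK].
under eq_bigr do rewrite extE.
rewrite -(pair_bigA _ (fun b w => f (signed_sum x w +
  (if b then x n else - x n)))) /=.
by rewrite big_bool.
Qed.

Lemma le_rmean n x f g : (forall y, f y <= g y) -> rmean n x f <= rmean n x g.
Proof.
by move=> fg; rewrite /rmean ler_pM2l ?exprn_gt0 ?invr_gt0// ler_sum.
Qed.

Lemma eq_rmean n x f g : f =1 g -> rmean n x f = rmean n x g.
Proof. by move=> fg; congr (_ * _); apply: eq_bigr => w _. Qed.

Lemma eq_rmean_seq n x u f :
  (forall i, (i < n)%N -> x i = u i) -> rmean n x f = rmean n u f.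
Proof.
move=> xu; congr (_ * _); apply: eq_bigr => w _; congr f.
by apply: eq_bigr => i _; rewrite xu.
Qed.

Lemma rmeanD n x f g :
  rmean n x (fun y => f y + g y) = rmean n x f + rmean n x g.
Proof. by rewrite /rmean big_split mulrDr. Qed.

Lemma rmeanZ n x c f : rmean n x (fun y => c * f y) = c * rmean n x f.
Proof. by rewrite /rmean -mulr_sumr mulrCA. Qed.

Lemma rmean_sum n x (I : Type) (r : seq I) (F : I -> V -> R) :
  rmean n x (fun y => \sum_(i <- r) F i y) = \sum_(i <- r) rmean n x (F i).
Proof. by rewrite /rmean exchange_big mulr_sumr. Qed.

Lemma rmean_cst n x (c : R) : rmean n x (fun=> c) = c.
Proof.
elim: n => [|n IH]; first by rewrite rmean0.
by rewrite rmeanS IH; lra.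
Qed.

Lemma rmean_ge0 n x f : (forall y, 0 <= f y) -> 0 <= rmean n x f.
Proof. by move=> f0; rewrite -[leLHS](rmean_cst n x 0) le_rmean. Qed.

(** The last sign is absorbed into the shift, so that statements quantified over [z] pass through
    the induction. *)
Lemma rmeanS_shift n x f z :
  rmean n.+1 x (fun y => f (z + y)) =
  2^-1 * (rmean n x (fun y => f (z + x n + y)) +
          rmean n x (fun y => f (z - x n + y))).
Proof.
rewrite rmeanS; congr (_ * (_ + _)); apply: eq_rmean => y.
  by rewrite addrA addrAC.
by rewrite addrA addrAC.
Qed.

(** The three sums are coupled through the same sign vector. *)
Lemma rmean_le_add n u v f g h :
    (forall y z, f (y + z) <= g y + h z) ->
  rmean n (fun i => u i + v i) f <= rmean n u g + rmean n v h.
Proof.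
move=> fgh; rewrite /rmean -mulrDr -big_split ler_pM2l ?exprn_gt0 ?invr_gt0//.
apply: ler_sum => w _; rewrite /signed_sum /=.
rewrite (eq_bigr (fun i : 'I_n => (if w i then u i else - u i) +
   (if w i then v i else - v i))); first by rewrite big_split fgh.
by move=> i _; case: ifP => // _; rewrite opprD.
Qed.

Lemma rmean_addn k n x f : (forall i, (i < k)%N -> x i = 0) ->
  rmean (n + k) x f = rmean n (fun i => x (i + k)%N) f.
Proof.
move=> x0; elim: n f => [|n IH] f; last by rewrite addSn !rmeanS !IH.
rewrite add0n rmean0; elim: k x0 f => [|k IH] x0 f; first by rewrite rmean0.
rewrite rmeanS x0// !IH; last 2 first.
- by move=> i ik; rewrite x0// ltnW.
- by move=> i ik; rewrite x0// ltnW.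
by rewrite subr0 addr0; lra.
Qed.

Lemma rmean_tail0 k n x f : (k <= n)%N ->
    (forall i, (k <= i < n)%N -> x i = 0) ->
  rmean n x f = rmean k x f.
Proof.
move=> + x0; elim: n x0 => [|n IH] x0; first by rewrite leqn0 => /eqP ->.
rewrite leq_eqVlt => /predU1P[->//|]; rewrite ltnS => kn.
have xn0 : x n = 0 by rewrite x0// kn ltnSn.
have IHn : rmean n x f = rmean k x f.
  by apply: IH => // i /andP[ki ni]; rewrite x0// ki ltnS ltnW.
rewrite -IHn rmeanS xn0.
rewrite !(@eq_rmean n x _ f); first lra.
  by move=> y; rewrite subr0.
by move=> y; rewrite addr0.
Qed.

Lemma rmean_morph (W : zmodType) n x (phi : V -> W) (f : W -> R) :
    phi 0 = 0 -> {morph phi : y z / y + z} ->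
  rmean n x (f \o phi) = rmean n (phi \o x) f.
Proof.
move=> phi0 phiD; congr (_ * _); apply: eq_bigr => w _ /=; congr f.
have phiN y : phi (- y) = - phi y.
  by apply/eqP; rewrite -addr_eq0 -phiD addNr phi0.
rewrite /signed_sum (big_morph phi phiD phi0).
by apply: eq_bigr => i _; case: ifP.
Qed.

Lemma ler_rmean_sqr n x f g t :
  2 * t * rmean n x (fun y => f y * g y) <=
  rmean n x (fun y => f y ^+ 2) + t ^+ 2 * rmean n x (fun y => g y ^+ 2).
Proof.
rewrite -!rmeanZ -rmeanD; apply: le_rmean => y.
have := sqr_ge0 (f y - t * g y); nra.
Qed.

Lemma rmean_CauchySchwarz n x f g :
  rmean n x (fun y => f y * g y) <=
  Num.sqrt (rmean n x (fun y => f y ^+ 2)) *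
  Num.sqrt (rmean n x (fun y => g y ^+ 2)).
Proof.
set H := rmean n x _; set F := rmean n x _; set G := rmean n x _.
have F0 : 0 <= F by apply: rmean_ge0 => y; exact: sqr_ge0.
have G0 : 0 <= G by apply: rmean_ge0 => y; exact: sqr_ge0.
have key t : 2 * t * H <= F + t ^+ 2 * G := ler_rmean_sqr n x f g t.
suff : H ^+ 2 <= F * G.
  move=> HFG; rewrite -sqrtrM//; apply: le_trans (ler_norm _) _.
  by rewrite -sqrtr_sqr ler_wsqrtr.
have [G00|Gn0] := eqVneq G 0.
  rewrite G00 mulr0; have [->|Hn0] := eqVneq H 0; first by rewrite expr0n.
  (* This [t] turns [key] into F + 1 <= F, so H vanishes together with G. *)
  have := key ((F + 1) / (2 * H)); rewrite G00 mulr0 addr0.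
  have -> : 2 * ((F + 1) / (2 * H)) * H = F + 1 by field.
  lra.
have Gp : 0 < G by rewrite lt_def Gn0.
(* The minimizer in t of F - 2tH + t^2 G. *)
have := key (H / G).
have -> : 2 * (H / G) * H = 2 * H ^+ 2 / G by field.
have -> : (H / G) ^+ 2 * G = H ^+ 2 / G by field.
rewrite -lerBlDr -mulrBl ler_pdivrMr//; nra.
Qed.

Lemma rmean_Minkowski n x f g h :
    (forall y, 0 <= h y) -> (forall y, h y <= f y + g y) ->
  Num.sqrt (rmean n x (fun y => h y ^+ 2)) <=
  Num.sqrt (rmean n x (fun y => f y ^+ 2)) +
  Num.sqrt (rmean n x (fun y => g y ^+ 2)).
Proof.
move=> h0 hfg; set F := rmean n x (fun y => f y ^+ 2).
set G := rmean n x (fun y => g y ^+ 2).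
have F0 : 0 <= F by apply: rmean_ge0 => y; exact: sqr_ge0.
have G0 : 0 <= G by apply: rmean_ge0 => y; exact: sqr_ge0.
rewrite -(@ger0_norm _ (_ + _)) ?addr_ge0 ?sqrtr_ge0// -sqrtr_sqr ler_wsqrtr//.
rewrite sqrrD !sqr_sqrtr// -mulr_natr.
apply: (@le_trans _ _ (rmean n x (fun y => f y ^+ 2 + g y ^+ 2 +
   2 * (f y * g y)))).
  apply: le_rmean => y.
  have := h0 y; have := hfg y; nra.
rewrite !rmeanD rmeanZ -/F -/G.
have := rmean_CauchySchwarz n x f g; rewrite -/F -/G; lra.
Qed.

End rmean_theory.

(** * Contraction and Kahane inequalities *)

Section rnorm_theory.
Context {R : realType} {X : normedModType R[i]}.
Implicit Types (x y : X) (c : R).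

Lemma rnormE x : `|x| = (rnorm x)%:C.
Proof. by rewrite /rnorm RRe_real// ger0_real. Qed.

Lemma rnorm_ge0 x : 0 <= rnorm x.
Proof. by rewrite -ler0c -rnormE. Qed.

Lemma rnorm0 : rnorm (0 : X) = 0.
Proof. by rewrite /rnorm normr0. Qed.

Lemma rnorm_eq0 x : (rnorm x == 0) = (x == 0).
Proof. by rewrite -(inj_eq (@complexI R)) -rnormE normr_eq0. Qed.

Lemma rnormD x y : rnorm (x + y) <= rnorm x + rnorm y.
Proof. by rewrite -lecR rmorphD /= -!rnormE ler_normD. Qed.

Lemma rnormN x : rnorm (- x) = rnorm x.
Proof. by rewrite /rnorm normrN. Qed.

Lemma rnormZ c x : rnorm (c%:C *: x) = `|c| * rnorm x.
Proof.
apply: (@complexI R); rewrite -rnormE normrZ rmorphM /= -rnormE; congr (_ * _).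
by rewrite normc_def /= expr0n addr0 sqrtr_sqr.
Qed.

Lemma rnorm_convex c x y : -1 <= c <= 1 ->
  rnorm (x + c%:C *: y) <=
  (1 + c) / 2 * rnorm (x + y) + (1 - c) / 2 * rnorm (x - y).
Proof.
move=> /andP[c1 c2].
have -> : x + c%:C *: y =
    ((1 + c) / 2)%:C *: (x + y) + ((1 - c) / 2)%:C *: (x - y).
  rewrite !scalerDr scalerN addrACA -scalerDl -scalerBl -rmorphD -rmorphB/=.
  have -> : (1 + c) / 2 + (1 - c) / 2 = 1 by field.
  have -> : (1 + c) / 2 - (1 - c) / 2 = c by field.
  by rewrite scale1r.
apply: le_trans (rnormD _ _) _.
by rewrite !rnormZ !ger0_norm//; lra.
Qed.

(** One sign is integrated at a time, with a free shift. For the last sign, the convexity bounds for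
    [c] and [- c] are added: their weights on each endpoint sum to 1. *)
Lemma rmean_contraction n (u v : nat -> X) x :
    (forall i, (i < n)%N -> exists2 c : R, -1 <= c <= 1 & u i = c%:C *: v i) ->
  rmean n u (fun y => rnorm (x + y)) <= rmean n v (fun y => rnorm (x + y)).
Proof.
elim: n x => [|n IH] x uv; first by rewrite !rmean0.
have {}IH z : rmean n u (fun y => rnorm (z + y)) <=
    rmean n v (fun y => rnorm (z + y)).
  by apply: IH => i ni; apply: uv; rewrite ltnS ltnW.
have [c c1 unE] := uv n (ltnSn n).
rewrite !(rmeanS_shift _ _ (@rnorm R X)) ler_pM2l ?invr_gt0//.
apply: le_trans (lerD (IH _) (IH _)) _.
rewrite -!rmeanD; apply: le_rmean => y; rewrite unE.
have cN1 : -1 <= - c <= 1 by lra.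
have := rnorm_convex (x + y) (v n) c1.
have := rnorm_convex (x + y) (v n) cN1.
rewrite rmorphN scaleNr.
rewrite !(addrAC x _ y).
lra.
Qed.

Lemma rmean_rnorm_contraction n (u v : nat -> X) :
    (forall i, (i < n)%N -> exists2 c : R, -1 <= c <= 1 & u i = c%:C *: v i) ->
  rmean n u (@rnorm R X) <= rmean n v (@rnorm R X).
Proof.
move=> uv; have := rmean_contraction 0 uv.
by rewrite !(@eq_rmean _ _ _ _ (fun y => rnorm (0 + y)) (@rnorm R X))// => y;
  rewrite add0r.
Qed.

End rnorm_theory.

(** Bonami's two-point inequality for the exponent 2^(k+1), with constant the exponent minus one.
    Squaring replaces (u, v) by (u^2 + v^2, 2uv) and halves the exponent; the induction step then
    leaves the nonnegative remainder 4c(c-1)v^4. *)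
Lemma two_point (R : realFieldType) k (u v : R) :
  (u + v) ^+ (2 ^ k.+1) + (u - v) ^+ (2 ^ k.+1) <=
  2 * (u ^+ 2 + (2 ^+ k.+1 - 1) * v ^+ 2) ^+ (2 ^ k).
Proof.
elim: k u v => [|k IH] u v.
  by rewrite expn1 expn0 !expr1; nra.
rewrite (expnS 2 k.+1) !exprM.
have -> : (u + v) ^+ 2 = (u ^+ 2 + v ^+ 2) + 2 * u * v by ring.
have -> : (u - v) ^+ 2 = (u ^+ 2 + v ^+ 2) - 2 * u * v by ring.
apply: le_trans (IH _ _) _.
have c0 : 1 <= 2 ^+ k.+1 :> R by rewrite exprn_ege1 ?ler1n.
rewrite ler_pM2l ?ltr0n// (expnS 2 k) exprM.
have : 2 ^+ k.+2 = 2 * 2 ^+ k.+1 :> R by rewrite exprS.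
move: (2 ^+ k.+2) (2 ^+ k.+1) c0 => d c c0 ->.
rewrite lerXn2r ?nnegrE ?sqr_ge0//.
  by rewrite addr_ge0 ?sqr_ge0// mulr_ge0 ?sqr_ge0 ?subr_ge0.
rewrite -subr_ge0.
have -> : (u ^+ 2 + (2 * c - 1) * v ^+ 2) ^+ 2 -
   ((u ^+ 2 + v ^+ 2) ^+ 2 + (c - 1) * (2 * u * v) ^+ 2) =
   (4 * c * (c - 1)) * v ^+ 4 by ring.
rewrite mulr_ge0 ?exprn_even_ge0// mulr_ge0//; lra.
Qed.

(** * Hypercontractivity and comparison of the first, second and even moments *)

Section Kahane.
Context {R : realType} {X : normedModType R[i]}.
Implicit Types (x : nat -> X).

Let rms n x (z : X) := Num.sqrt (rmean n x (fun y => rnorm (z + y) ^+ 2)).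

(** Pointwise convexity of the norm, followed by Minkowski's inequality for the mean over the
    signs. *)
Let rms_convex n x c (z v : X) : -1 <= c <= 1 ->
  rms n x (z + c%:C *: v) <=
  (1 + c) / 2 * rms n x (z + v) + (1 - c) / 2 * rms n x (z - v).
Proof.
move=> c1.
have rmsM a w : 0 <= a ->
    a * rms n x w = Num.sqrt (rmean n x (fun y => (a * rnorm (w + y)) ^+ 2)).
  move=> a0; rewrite /rms -{1}(ger0_norm a0) -sqrtr_sqr -sqrtrM ?sqr_ge0//.
  by rewrite -rmeanZ; congr Num.sqrt; apply: eq_rmean => y; rewrite exprMn.
rewrite !rmsM; [|lra|lra].
apply: rmean_Minkowski => y; first exact: rnorm_ge0.
have := rnorm_convex (z + y) v c1.
by rewrite (addrAC z _ y) (addrAC z v y) (addrAC z (- v) y).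
Qed.

(* Integrate one sign at a time: the root mean square over the other signs is a
   convex function of z, hence at z +- rho v it is dominated by the affine
   interpolation of its values at z +- v, where [two_point] applies. *)
Lemma hypercontractive n k x (rho : R) (z : X) :
    0 <= rho <= 1 -> rho ^+ 2 * (2 ^+ k.+1 - 1) <= 1 ->
  rmean n (fun i => rho%:C *: x i) (fun y => rnorm (z + y) ^+ (2 ^ k.+1)) <=
  (rmean n x (fun y => rnorm (z + y) ^+ 2)) ^+ (2 ^ k).
Proof.
move=> rho01 rhok; elim: n z => [|n IH] z.
  by rewrite !rmean0 -exprM -expnS.
rewrite (rmeanS_shift _ _ (fun y => rnorm y ^+ (2 ^ k.+1))).
rewrite (rmeanS_shift _ _ (fun y => rnorm y ^+ 2)).
pose v := x n; rewrite -/v.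
have rmsE w : rmean n x (fun y => rnorm (w + y) ^+ 2) = rms n x w ^+ 2.
  by rewrite sqr_sqrtr// rmean_ge0// => y; exact: sqr_ge0.
rewrite ler_pdivrMl//.
apply: le_trans (lerD (IH _) (IH _)) _.
rewrite !rmsE -!exprM -!expnS.
have rho1 : -1 <= rho <= 1 by lra.
have rhoN1 : -1 <= - rho <= 1 by lra.
have := rms_convex n x z v rho1.
have := rms_convex n x z v rhoN1.
rewrite rmorphN scaleNr.
have rms0 w : 0 <= rms n x w by exact: sqrtr_ge0.
move: (rms0 (z + v)) (rms0 (z - v)) (rms0 (z + rho%:C *: v))
  (rms0 (z - rho%:C *: v)).
move: (rms n x (z + v)) (rms n x (z - v)) (rms n x (z + rho%:C *: v))
  (rms n x (z - rho%:C *: v)) => A B P Q A0 B0 P0 Q0 HQ HP.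
(* With A and B the root mean squares at z + v and z - v, the interpolated bounds are al + rho be
   and al - rho be, and al^2 + be^2 = (A^2 + B^2) / 2 is the target. *)
pose al := (A + B) / 2; pose be := (A - B) / 2.
apply: (@le_trans _ _ ((al + rho * be) ^+ (2 ^ k.+1) +
    (al - rho * be) ^+ (2 ^ k.+1))).
  apply: lerD; rewrite lerXn2r ?nnegrE// /al /be; nra.
apply: le_trans (two_point _ _ _) _.
rewrite ler_pM2l//.
have c0 : 1 <= 2 ^+ k.+1 :> R by rewrite exprn_ege1 ?ler1n.
rewrite lerXn2r ?nnegrE//.
- by rewrite addr_ge0 ?sqr_ge0// mulr_ge0 ?sqr_ge0 ?subr_ge0.
- by rewrite mulr_ge0 ?invr_ge0 ?addr_ge0 ?sqr_ge0.
apply: (@le_trans _ _ (al ^+ 2 + be ^+ 2)).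
  rewrite lerD2l exprMn mulrA (mulrC _ (rho ^+ 2)).
  by rewrite ler_piMl ?sqr_ge0.
by rewrite /al /be; lra.
Qed.

Lemma rmean_even_moment n k x :
  rmean n x (fun y => rnorm y ^+ (2 ^ k.+1)) <=
  (2 ^+ k.+1) ^+ (2 ^ k.+1) * rmean n x (fun y => rnorm y ^+ 2) ^+ (2 ^ k).
Proof.
have c1 : 1 <= 2 ^+ k.+1 :> R by rewrite exprn_ege1 ?ler1n.
have c0 : 0 < 2 ^+ k.+1 :> R by rewrite (lt_le_trans ltr01).
(* A simple admissible factor: rho^2 (2^(k+1) - 1) = rho (1 - rho) <= 1. Homogeneity of the norm
   pulls out rho^(2^(k+1)), the inverse of the stated constant. *)
pose rho : R := (2 ^+ k.+1)^-1.
have rho0 : 0 < rho by rewrite invr_gt0.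
have rho1 : rho <= 1 by rewrite invf_le1.
have := @hypercontractive n k x rho 0.
rewrite (ltW rho0) rho1 => /(_ isT) H.
have {}H : rho ^+ (2 ^ k.+1) * rmean n x (fun y => rnorm y ^+ (2 ^ k.+1)) <=
    rmean n x (fun y => rnorm y ^+ 2) ^+ (2 ^ k).
  rewrite (@eq_rmean _ _ _ x (fun y => rnorm y ^+ 2)
    (fun y => rnorm (0 + y) ^+ 2)); last by move=> y; rewrite add0r.
  apply: le_trans (H _); last first.
    rewrite /rho expr2 -mulrA mulrBr mulVf ?gt_eqF// mulr1.
    have : rho * (1 - rho) <= 1 by nra.
    exact.
  rewrite -rmeanZ.
  rewrite (_ : (fun i => _) = (fun y => rho%:C *: y) \o x)//.
  rewrite -rmean_morph ?scaler0//; last by move=> y w; rewrite scalerDr.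
  apply: le_rmean => y /=.
  by rewrite add0r rnormZ exprMn (ger0_norm (ltW rho0)).
by rewrite -ler_pdivrMl ?exprn_gt0// -exprVn.
Qed.

(* Split at 32 B, B the root mean square: the part above 32 B is controlled by
   the fourth moment, at most 4^4 B^4, and 43 > 32 * 4 / 3. *)
Lemma rmean_sqr_le n x :
  Num.sqrt (rmean n x (fun y => rnorm y ^+ 2)) <= 43 * rmean n x (@rnorm R X).
Proof.
set B := Num.sqrt _; set m := rmean n x _.
have m0 : 0 <= m by apply: rmean_ge0 => y; exact: rnorm_ge0.
have BE : rmean n x (fun y => rnorm y ^+ 2) = B ^+ 2.
  by rewrite sqr_sqrtr// rmean_ge0// => y; exact: sqr_ge0.
have : 0 <= B by exact: sqrtr_ge0.
rewrite le_eqVlt => /predU1P[<-|B0]; first by rewrite mulr_ge0.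
have := rmean_even_moment n 1 x; rewrite BE expn1 (_ : 2 ^ 2 = 4)%N// => H4.
have : B ^+ 2 <= 32 * B * m +
    ((32 * B) ^+ 2)^-1 * rmean n x (fun y => rnorm y ^+ 4).
  rewrite -BE -!rmeanZ -rmeanD; apply: le_rmean => y.
  have y0 := rnorm_ge0 y.
  have [yB|By] := leP (rnorm y) (32 * B).
    rewrite (@le_trans _ _ (32 * B * rnorm y))//; first nra.
    by rewrite lerDl mulr_ge0 ?exprn_ge0// invr_ge0 sqr_ge0.
  rewrite (@le_trans _ _ (((32 * B) ^+ 2)^-1 * rnorm y ^+ 4))//.
    rewrite ler_pdivlMl ?exprn_gt0 ?mulr_gt0//.
    rewrite (_ : rnorm y ^+ 4 = rnorm y ^+ 2 * rnorm y ^+ 2); last by ring.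
    by rewrite ler_wpM2r ?sqr_ge0// lerXn2r ?nnegrE// ltW// mulr_gt0.
  by rewrite lerDr !mulr_ge0// ltW.
have : ((32 * B) ^+ 2)^-1 * rmean n x (fun y => rnorm y ^+ 4) <= B ^+ 2 / 4.
  rewrite ler_pdivrMl ?exprn_gt0 ?mulr_gt0//.
  by apply: le_trans H4 _; rewrite le_eqVlt; apply/orP; left; apply/eqP; field.
move=> h1 h2.
have : B * (3 / 4 * B) <= B * (32 * m) by nra.
by rewrite ler_pM2l//; lra.
Qed.

End Kahane.

(** * Real moments *)

Section moments.
Context {R : realType} {V : zmodType}.
Implicit Types (x : nat -> V) (h : V -> R).

Lemma rmean_eq0 n x h : (forall y, 0 <= h y) -> rmean n x h = 0 ->
  forall w : {ffun 'I_n -> bool}, h (signed_sum x w) = 0.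
Proof.
move=> h0 /eqP; rewrite mulf_eq0 expf_eq0 invr_eq0 pnatr_eq0 andbF /=.
by rewrite psumr_eq0// => /allP H w; apply/eqP/H; rewrite mem_index_enum.
Qed.

Lemma powR_le_addX (t r : R) m : 0 <= t -> 0 <= r <= m%:R ->
  t `^ r <= 1 + t ^+ m.
Proof.
move=> t0 /andP[r0 rm]; have [t1|t1] := leP t 1.
  rewrite (@le_trans _ _ 1)// ?lerDl ?exprn_ge0//.
  have := ge0_ler_powR r0 t0 (@ler01 R) t1.
  by rewrite powR1.
rewrite (@le_trans _ _ (t ^+ m))// ?lerDr// -powR_mulrn//.
by rewrite ler_powR// ltW.
Qed.

(** Jensen's inequality up to the factor 2^r. With m the mean of h^r and B = m^(1/r), pointwise h <=
    B + B h^r / m, because h / B <= (h / B)^r wherever h > B; the mean of the right side is 2B. *)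
Lemma powR_rmean_le n x h (r : R) : 1 <= r -> (forall y, 0 <= h y) ->
  rmean n x h `^ r <= 2 `^ r * rmean n x (fun y => h y `^ r).
Proof.
move=> r1 h0; have r0 : 0 < r by rewrite (lt_le_trans ltr01).
set m := rmean n x (fun y => h y `^ r).
have m0 : 0 <= m by apply: rmean_ge0 => y; exact: powR_ge0.
move: m0; rewrite le_eqVlt => /predU1P[m0|m0].
  have -> : rmean n x h = 0.
    rewrite /rmean big1 ?mulr0// => w _.
    have := rmean_eq0 (fun y => powR_ge0 (h y) r) (esym m0) w.
    by move/powR_eq0_eq0.
  by rewrite powR0 ?gt_eqF// -m0 mulr0.
pose B := m `^ r^-1.
have B0 : 0 < B by exact: powR_gt0.
have Br : B `^ r = m by rewrite -powRrM mulVf ?gt_eqF// powRr1// ltW.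
rewrite -Br -powRM ?(ltW B0)//.
apply: (ge0_ler_powR (ltW r0)); rewrite ?nnegrE ?rmean_ge0 ?mulr_ge0 ?(ltW B0)//.
have -> : 2 * B = B + B * (m^-1 * m).
  by rewrite mulVf ?gt_eqF// mulr1 mulrDl mul1r.
rewrite /m -!rmeanZ -[X in X + _](rmean_cst n x) -rmeanD.
apply: le_rmean => y.
have [hB|Bh] := leP (h y) B.
  by rewrite (le_trans hB)// lerDl !mulr_ge0 ?invr_ge0 ?powR_ge0 ?(ltW B0) ?(ltW m0).
rewrite (@le_trans _ _ (B * (m^-1 * h y `^ r)))// ?lerDr ?(ltW B0)//.
have -> : h y = B * (h y / B) by rewrite mulrC divfK ?gt_eqF.
rewrite powRM ?divr_ge0 ?(ltW B0)// Br mulKf ?gt_eqF// ler_pM2l//.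
have t1 : 1 <= h y / B by rewrite ler_pdivlMr// mul1r ltW.
by rewrite -[leLHS]powRr1 ?ler_powR// (le_trans ler01).
Qed.

End moments.

(** Normalize by C = 43 m, which dominates the root mean square, and bound the r-th power by 1 plus
    an even power, whose mean hypercontractivity controls. The constant depends on [r] alone. *)
Lemma Kahane (R : realType) (r : R) : 0 < r ->
  exists2 K : R, 0 < K & forall (X : normedModType R[i]) n (x : nat -> X),
    rmean n x (fun y => rnorm y `^ r) <= K * rmean n x (@rnorm R X) `^ r.
Proof.
(* Then r < k + 1 < 2^(k+1), so the even moment of order 2^(k+1) dominates. *)
move=> r0; pose k := Num.trunc r.
pose D : R := 1 + (2 ^+ k.+1) ^+ (2 ^ k.+1).
have D0 : 0 < D by rewrite addr_gt0// !exprn_gt0.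
exists (D * 43 `^ r); first by rewrite mulr_gt0 ?powR_gt0.
move=> X n x; set m := rmean n x (@rnorm R X).
have m0 : 0 <= m by apply: rmean_ge0 => y; exact: rnorm_ge0.
rewrite -mulrA -powRM//.
set B := Num.sqrt (rmean n x (fun y => rnorm y ^+ 2)).
have Bm : B <= 43 * m by exact: rmean_sqr_le.
(* If the first moment is 0, every signed sum vanishes; otherwise C is positive and can be divided
   by. *)
move: m0; rewrite le_eqVlt => /predU1P[m0|m0].
  rewrite {1}/rmean big1 ?mulr0 ?mulr_ge0 ?powR_ge0 ?(ltW D0)// => w _.
  by rewrite (rmean_eq0 (@rnorm_ge0 R X) (esym m0)) powR0 ?gt_eqF.
set C := 43 * m; have C0 : 0 < C by rewrite mulr_gt0.
have BC : rmean n x (fun y => rnorm y ^+ 2) <= C ^+ 2.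
  rewrite -[leLHS]sqr_sqrtr ?rmean_ge0// => [|y]; last exact: sqr_ge0.
  by rewrite lerXn2r ?nnegrE ?sqrtr_ge0// ltW.
have rk : 0 <= r <= (2 ^ k.+1)%:R.
  rewrite ltW//= (le_trans (ltW (truncnS_gt r)))//.
  by rewrite ler_nat ltnW// ltn_expl.
rewrite (@le_trans _ _ (rmean n x (fun y =>
    C `^ r * (1 + (C ^+ (2 ^ k.+1))^-1 * rnorm y ^+ (2 ^ k.+1)))))//.
  apply: le_rmean => y; have y0 := rnorm_ge0 y.
  have -> : rnorm y `^ r = C `^ r * (rnorm y / C) `^ r.
    by rewrite -powRM ?divr_ge0 ?(ltW C0)// mulrC divfK ?gt_eqF.
  rewrite ler_pM2l ?powR_gt0// (le_trans (powR_le_addX _ rk)) ?divr_ge0 ?(ltW C0)//.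
  by rewrite expr_div_n mulrC.
rewrite rmeanZ mulrC ler_pM2r ?powR_gt0// rmeanD rmean_cst lerD2l rmeanZ.
rewrite ler_pdivrMl ?exprn_gt0// mulrC (le_trans (rmean_even_moment _ _ _))//.
rewrite ler_pM2l ?exprn_gt0// expnS exprM lerXn2r ?nnegrE ?sqr_ge0//.
by apply: rmean_ge0 => y; exact: sqr_ge0.
Qed.

(** * Independent signs on probability spaces *)

Definition sgb (R : pzRingType) (b : bool) : R := if b then 1 else -1.

Section coin.
Context {R : realType} (n : nat).
Local Notation cube := {ffun 'I_n -> bool}.

(* The sample space is nat: [coin] is uniform on the first 2^n integers, and the
   k-th integer stands for the k-th sign vector of [enum]. *)
Definition coin_path (k : nat) : cube := nth [ffun=> false] (enum {: cube}) k.

Lemma half_expn_ge0 : 0 <= 2^-1 ^+ n :> R.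
Proof. by rewrite exprn_ge0// invr_ge0. Qed.

Definition coin : set nat -> \bar R :=
  mscale (NngNum half_expn_ge0) (msum (fun k => \d_k) #|{: cube}|).

HB.instance Definition _ := Measure.on coin.

Lemma sum_coin_path (U : nmodType) (F : cube -> U) :
  \sum_(k < #|{: cube}|) F (coin_path k) = \sum_w F w.
Proof.
by rewrite -[RHS]big_enum /= (big_nth [ffun=> false]) -cardE big_mkord.
Qed.

Lemma coin_preimage (B : set cube) :
  coin (coin_path @^-1` B) = (2^-1 ^+ n * \sum_w \1_B w)%:E.
Proof.
rewrite /coin /mscale /msum /= EFinM; congr (_ * _)%E.
rewrite -(sum_coin_path (fun w => \1_B w)) -sumEFin.
by apply: eq_bigr => k _; rewrite /dirac /= !indicE.
Qed.

Let coin_setT : coin setT = 1%:E.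
Proof.
rewrite -(preimage_setT coin_path) coin_preimage.
under eq_bigr do rewrite indicT.
by rewrite sumr_const card_ffun card_bool card_ord natrX -exprMn mulVf ?expr1n.
Qed.

HB.instance Definition _ := Measure_isProbability.Build _ _ _ coin coin_setT.

Definition coin_sign (i : 'I_n) (k : nat) : R := sgb R (coin_path k i).

Let coin_sign_measurable i : measurable_fun setT (coin_sign i).
Proof. by []. Qed.

HB.instance Definition _ (i : 'I_n) :=
  isMeasurableFun.Build _ _ _ _ (coin_sign i) (coin_sign_measurable i).

Lemma integral_coin (F : cube -> R) : (forall w, 0 <= F w) ->
  (\int[coin]_k (F (coin_path k))%:E = (2^-1 ^+ n * \sum_w F w)%:E)%E.
Proof.
move=> F0; rewrite ge0_integral_mscale//= ?lee_fin//; last first.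
  by move=> k _; rewrite lee_fin.
rewrite EFinM; congr (_ * _)%E.
rewrite ge0_integral_measure_sum//; last by move=> k _; rewrite lee_fin.
rewrite -sum_coin_path -sumEFin; apply: eq_bigr => k _.
by rewrite integral_dirac//= diracT mul1e.
Qed.

(** The indicator of the event is a product with one factor per coordinate, and the sum of such a
    product over the cube is the product of the sums. *)
Lemma coin_rule (s : seq 'I_n) (A : 'I_n -> set R) : uniq s ->
  coin [set k | forall i, i \in s -> A i (coin_sign i k)] =
  (\prod_(i <- s) (2^-1 * (\1_(A i) 1 + \1_(A i) (-1))))%:E.
Proof.
move=> us.
rewrite (_ : mkset _ =
  coin_path @^-1` [set w | forall i, i \in s -> A i (sgb R (w i))])//.
rewrite coin_preimage; congr EFin.
(* Coordinates outside [s] carry the factor 1, whose average over the sign is 1. *)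
pose G i b : R := if i \in s then \1_(A i) (sgb R b) else 1.
transitivity (2^-1 ^+ n * \sum_(w : cube) \prod_i G i (w i)).
  congr (_ * _); apply: eq_bigr => w _; rewrite indicE.
  have [H|H] := pselect (forall i, i \in s -> A i (sgb R (w i))).
    rewrite mem_set// big1// => j _; rewrite /G; case: ifP => // /H Aj.
    by rewrite indicE mem_set.
  have [j /not_implyP[sj Aj]] := (existsNP _).2 H.
  by rewrite memNset// (bigD1 j)//= /G sj indicE memNset// mul0r.
rewrite [RHS]big_uniq//= [RHS]big_mkcond /=.
transitivity (2^-1 ^+ n * \prod_i \sum_b G i b).
  by rewrite bigA_distr_bigA.
transitivity (\prod_(i < n) (2^-1 * \sum_b G i b)).
  by rewrite big_split /= prodr_const card_ord.
apply: eq_bigr => i _; rewrite big_bool /G; case: ifP => // _.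
by rewrite mulVf.
Qed.

Lemma iid_coin : @iid_rademacher _ _ R coin 'I_n coin_sign.
Proof.
have one i (B : set R) : coin (coin_sign i @^-1` B) =
    (2^-1 * (\1_B 1 + \1_B (-1)))%:E.
  have := @coin_rule [:: i] (fun=> B) isT.
  rewrite big_seq1 => <-; congr (coin _); apply/seteqP; split => k /=.
    by move=> H j; rewrite inE => /eqP ->.
  by apply; rewrite inE.
have N11 : (-1 == 1 :> R) = false by apply/negbTE; rewrite lt_eqF//; lra.
split=> [i|s A us mA].
  split.
    apply: etrans (one i [set 1]) _; rewrite !indicE.
    by rewrite mem_set// memNset ?addr0 ?mulr1//= => /eqP; rewrite N11.
  apply: etrans (one i [set -1]) _; rewrite !indicE.
  by rewrite memNset ?mem_set ?add0r ?mulr1//= => /eqP; rewrite eq_sym N11.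
apply: etrans (coin_rule A us) _; rewrite -prodEFin.
by apply: eq_bigr => i _; exact: esym (one i (A i)).
Qed.

Lemma expectation_coin (X : normedModType R[i]) (x : nat -> X) (f : X -> R) :
    (forall y, 0 <= f y) ->
  ('E_coin[fun k => f (\sum_(i < n) (coin_sign i k)%:C *: x i)%R] =
   (rmean n x f)%:E)%E.
Proof.
move=> f0; rewrite unlock /rmean -integral_coin => [|w]; last exact: f0.
apply: eq_integral => k _; congr (f _)%:E; apply: eq_bigr => i _.
rewrite /coin_sign /sgb; case: ifP => _; first by rewrite scale1r.
by rewrite rmorphN scaleNr scale1r.
Qed.

End coin.

(** The integral of a nonnegative function is a supremum over the simple functions below it, hence
    monotone for arbitrary functions. *)
Lemma ge0_le_integral_setT d (T : measurableType d) (R : realType)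
    (mu : {measure set T -> \bar R}) (f g : T -> \bar R) :
    (forall x, 0 <= f x)%E -> (forall x, f x <= g x)%E ->
  (\int[mu]_x f x <= \int[mu]_x g x)%E.
Proof.
move=> f0 fg; have g0 x : (0 <= g x)%E by rewrite (le_trans (f0 x)).
rewrite !ge0_integralTE//; apply: le_ereal_sup => _ [h hf <-].
by exists h => // x; exact: le_trans (hf x) (fg x).
Qed.

Section expectation_rademacher.
Context {R : realType} {X : normedModType R[i]}.
Context {d : measure_display} {Omega : measurableType d}.
Context (P : probability Omega R) (e : nat -> {RV P >-> R}).
Hypothesis iid : iid_rademacher e.

Let measurable_preimage1 i (r : R) : measurable (e i @^-1` [set r]).
Proof. by rewrite -[X in measurable X]setTI; exact: measurable_funP. Qed.

Lemma rademacher_ae i : P (e i @^-1` (~` [set 1; -1])) = 0%E.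
Proof.
have [e1 eN1] := iid.1 i.
have m1 (r : R) := measurable_preimage1 i r.
rewrite -preimage_setC preimage_setU probability_setC; last exact: measurableU.
rewrite measureU//; last first.
  rewrite -preimage_setI (_ : _ `&` _ = set0) ?preimage_set0//.
  by apply/seteqP; split => // r [->] /eqP; rewrite gt_eqF//; lra.
transitivity (1 - (2^-1%:E + 2^-1%:E) : \bar R)%E.
  by congr (1 - (_ + _))%E; [exact: e1|exact: eN1].
by rewrite -EFinD; congr EFin; lra.
Qed.

(* Measurability of the integrand is never needed: it is dominated by a
   measurable function, infinite where some sign is not 1 or -1. *)
Lemma expectation_rademacher_le n (x : nat -> X) (f : X -> R) :
    (forall y, 0 <= f y) ->
  ('E_P[fun w => f (\sum_(k < n) (e k w)%:C *: x k)%R] <= (rmean n x f)%:E)%E.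
Proof.
move=> f0; rewrite unlock.
(* The variables [e] are indexed by [nat], so sign vectors are extended by the default 1 beyond
   [n]. *)
pose sg (s : {ffun 'I_n -> bool}) (i : nat) : R :=
  if insub i is Some j then sgb R (s j) else 1.
have sgE s (i : 'I_n) : sg s i = sgb R (s i) by rewrite /sg valK.
pose B s := [set w | forall i, i \in iota 0 n -> [set sg s i] (e i w)].
pose Nul i := e i @^-1` (~` [set 1; -1]).
have mNul i : measurable (Nul i).
  rewrite -[Nul i]setTI; apply: measurable_funP => //.
  by apply: measurableC; apply: measurableU.
have BE s : B s = \bigcap_(i in [set i | i \in iota 0 n]) (e i @^-1` [set sg s i]).
  by apply/seteqP; split => w /=.
have mB s : measurable (B s).
  rewrite BE; by apply: bigcap_measurableType.
have PB s : P (B s) = (2^-1 ^+ n)%:E.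
  rewrite /B (iid.2 _ (fun i => [set sg s i]) (iota_uniq 0 n))//.
  transitivity (\prod_(i <- iota 0 n) (2^-1 : R)%:E)%E.
    apply: eq_bigr => i _; have [e1 eN1] := iid.1 i.
    by rewrite /sg; case: insubP => [j _ _|_] //=; rewrite /sgb; case: ifP.
  by rewrite prodEFin big_const_seq count_predT size_iota -Monoid.iteropE.
pose g w := (\sum_(s : {ffun 'I_n -> bool}) ((f (signed_sum x s))%:E * (\1_(B s) w)%:E) +
  \sum_(i < n) +oo * (\1_(Nul i) w)%:E)%E.
have term0 s w : (0 <= (f (signed_sum x s))%:E * (\1_(B s) w)%:E)%E.
  by rewrite -EFinM lee_fin mulr_ge0// indicE.
have termy i w : (0 <= +oo * (\1_(Nul i) w)%:E :> \bar R)%E.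
  by rewrite mule_ge0// lee_fin indicE.
apply: (@le_trans _ _ (\int[P]_w g w)%E).
  apply: ge0_le_integral_setT => w; first by rewrite lee_fin.
  have [[i Ni]|/forallNP Nw] := pselect (exists i : 'I_n, Nul i w).
    have N1 : \1_(Nul i) w = 1 :> R by rewrite indicE mem_set.
    rewrite /g; move: (f (\sum_(k < n) _)) => y; rewrite (bigD1 i)// N1 mule1 /=.
    rewrite addye ?addey ?leey//.
    - by rewrite gt_eqF// (@lt_le_trans _ _ 0%E)// sume_ge0.
    - by rewrite gt_eqF// (@lt_le_trans _ _ 0%E)// sume_ge0.
  (* Off the null sets the signs at [w] determine [s]; then [w] lies in the cell [B s], whose term
     of [g] equals the integrand. *)
  pose s : {ffun 'I_n -> bool} := [ffun i : 'I_n => e i w == 1].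
  have es (i : 'I_n) : e i w = sgb R (s i).
    rewrite /s ffunE /sgb; case: eqP => // ei1.
    by have /contrapT[] := Nw i.
  have -> : \sum_(k < n) (e k w)%:C *: x k = signed_sum x s.
    apply: eq_bigr => i _; rewrite es /sgb; case: ifP => _.
      by rewrite scale1r.
    by rewrite rmorphN scaleNr scale1r.
  have B1 : \1_(B s) w = 1 :> R.
    rewrite indicE mem_set// => i; rewrite mem_iota /= add0n => ni.
    by have := es (Ordinal ni); rewrite -sgE.
  rewrite /g (bigD1 s)// B1.
  by rewrite mule1 /= -addeA leeDl// adde_ge0// sume_ge0.
rewrite ge0_integralD//; last 4 first.
- by move=> w _; rewrite sume_ge0.
- apply: emeasurable_sum => s; apply: emeasurable_funM => //.
  by apply/measurable_realfun.measurable_EFinP.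
- by move=> w _; rewrite sume_ge0.
- apply: emeasurable_sum => s; apply: emeasurable_funM => //.
  by apply/measurable_realfun.measurable_EFinP.
rewrite !ge0_integral_sum//; last 2 first.
- move=> s; apply: emeasurable_funM => //.
  by apply/measurable_realfun.measurable_EFinP.
- move=> s; apply: emeasurable_funM => //.
  by apply/measurable_realfun.measurable_EFinP.
rewrite [X in (_ + X)%E]big1 => [|i _]; last first.
  rewrite ge0_integralZl//; last first.
    by apply/measurable_realfun.measurable_EFinP.
  rewrite integral_indic// setIT.
  by apply: etrans (congr1 (mule +oo) (rademacher_ae i)) _; rewrite mule0.
rewrite adde0 /rmean mulr_sumr -sumEFin lee_sum// => s _.
rewrite ge0_integralZl//; last 2 first.
- by apply/measurable_realfun.measurable_EFinP.
- by rewrite lee_fin.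
rewrite integral_indic// setIT.
rewrite [X in (_ * X <= _)%E](_ : _ = (2^-1 ^+ n)%:E); last exact: PB.
by rewrite -EFinM mulrC.
Qed.

End expectation_rademacher.

(** * The orbit estimate *)

(** Type is tested on the space [coin], where it becomes an inequality between finite means. The
    length 0, left out by [of_type], is covered since 0 to the power [p] is 0 for nonzero [p]. *)
Lemma of_type_rmean (R : realType) (X : normedModType R[i]) (p : R) :
    p != 0 -> of_type X p ->
  exists2 K : R, 0 < K & forall n (x : nat -> X),
    rmean n x (fun y => rnorm y `^ p) <= K * \sum_(i < n) rnorm (x i) `^ p.
Proof.
move=> p0 [K K0 H]; exists K => // -[|n] x.
  by rewrite rmean0 rnorm0 powR0// big_ord0 mulr0.
have := H n.+1 (fun i => x i) isT _ _ _ _ (@iid_coin R n.+1).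
have := @expectation_coin R n.+1 X x (fun y => rnorm y `^ p)
  (fun y => powR_ge0 _ _).
by move=> /= ->; rewrite lee_fin.
Qed.

Lemma of_cotype_rmean (R : realType) (X : normedModType R[i]) (q : R) :
    of_cotype X q ->
  exists2 K : R, 0 < K & forall n (x : nat -> X),
    \sum_(i < n) rnorm (x i) `^ q <= K * rmean n x (fun y => rnorm y `^ q).
Proof.
move=> [K K0 H]; exists K => // -[|n] x.
  by rewrite rmean0 big_ord0 mulr_ge0 ?powR_ge0 ?(ltW K0).
have := H n.+1 (fun i => x i) isT _ _ _ _ (@iid_coin R n.+1).
have := @expectation_coin R n.+1 X x (fun y => rnorm y `^ q)
  (fun y => powR_ge0 _ _).
by move=> /= ->; rewrite -EFinM lee_fin.
Qed.

Lemma Cesaro_sum_le (R : realType) (X : normedModType R[i]) (T : X -> X) :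
    absolutely_Cesaro_bounded T ->
  exists2 C : R, 0 < C & forall n (x : X),
    \sum_(k < n) rnorm (iter k T x) <= C * n%:R * rnorm x.
Proof.
move=> [C C0 H]; exists C => // -[|n] x.
  by rewrite big_ord0 mulr0 mul0r.
have := le_trans (ereal_sup_ubound _) (H x) => /(_ (n.+1%:R^-1 *
  \sum_(k < n.+1) rnorm (iter k T x))%:E) h.
have {h} : ((n.+1%:R^-1 * \sum_(k < n.+1) rnorm (iter k T x))%:E <=
    (C * rnorm x)%:E)%E by apply: h; exists n.+1.
by rewrite lee_fin ler_pdivrMl ?ltr0n// mulrCA mulrA.
Qed.

Section rmean_norm.
Context {R : realType} {X : normedModType R[i]}.
Implicit Types (x u v : nat -> X).

Lemma rmean_rnorm_ge0 n x : 0 <= rmean n x (@rnorm R X).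
Proof. by apply: rmean_ge0 => y; exact: rnorm_ge0. Qed.

Lemma rmean_rnormZ n (c : R) x :
  rmean n (fun i => c%:C *: x i) (@rnorm R X) = `|c| * rmean n x (@rnorm R X).
Proof.
rewrite -rmeanZ (_ : (fun i => _) = (fun y => c%:C *: y) \o x)//.
rewrite -rmean_morph ?scaler0//; last by move=> y z; rewrite scalerDr.
by apply: eq_rmean => y /=; rewrite rnormZ.
Qed.

Lemma rmean_rnorm_sum n m (v : nat -> nat -> X) :
  rmean n (fun i => \sum_(k < m) v k i) (@rnorm R X) <=
  \sum_(k < m) rmean n (v k) (@rnorm R X).
Proof.
elim: m => [|m IH].
  rewrite big_ord0 (@rmean_tail0 _ _ 0)// ?rmean0 ?rnorm0//.
  by move=> i _; rewrite big_ord0.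
rewrite big_ord_recr /=; apply: le_trans (lerD IH (lexx _)).
rewrite (_ : (fun i => _) = fun i => \sum_(k < m) v k i + v m i).
  by apply: rmean_le_add => y z; exact: rnormD.
by apply/funext => i; rewrite big_ord_recr.
Qed.

Lemma rmean_rnorm_restrict n x (P : pred nat) :
  rmean n (fun i => if P i then x i else 0) (@rnorm R X) <=
  rmean n x (@rnorm R X).
Proof.
apply: rmean_rnorm_contraction => i _; case: ifP => _.
  by exists 1; [lra|rewrite scale1r].
by exists 0; [lra|rewrite scale0r].
Qed.

Lemma rmean_rnorm_trunc k n x : (k <= n)%N ->
  rmean k x (@rnorm R X) <= rmean n x (@rnorm R X).
Proof.
move=> kn; apply: le_trans (rmean_rnorm_restrict n x (fun i => i < k)%N).
rewrite (@rmean_tail0 _ _ k n)// => [|i /andP[ki _]]; last first.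
  by rewrite ltnNge ki.
by rewrite le_eqVlt (@eq_rmean_seq _ _ _ _ x) ?eqxx// => i ->.
Qed.

(** By contraction all terms but the i-th may be deleted, and one signed vector has constant
    norm. *)
Lemma rnorm_le_rmean n x i : (i < n)%N ->
  rnorm (x i) <= rmean n x (@rnorm R X).
Proof.
move=> ni; apply: le_trans (rmean_rnorm_restrict n x (fun k => k == i)).
rewrite (@rmean_tail0 _ _ i.+1 n)// => [|k /andP[ik _]]; last first.
  by rewrite gtn_eqF.
rewrite rmeanS eqxx (@rmean_tail0 _ _ 0 i)// => [|k /andP[_ ki]]; last first.
  by rewrite ltn_eqF.
rewrite (@rmean_tail0 _ _ 0 i)// => [|k /andP[_ ki]]; last first.
  by rewrite ltn_eqF.
rewrite !rmean0 add0r sub0r rnormN; lra.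
Qed.

End rmean_norm.

Section orbit.
Context {R : realType} {X : normedModType R[i]} (T : {linear X -> X}).
Implicit Types x y : X.

Lemma iter_linear0 k : iter k T 0 = 0.
Proof. by elim: k => //= k ->; rewrite linear0. Qed.

Lemma iter_linearD k : {morph iter k T : x y / x + y}.
Proof. by move=> x y; elim: k => //= k ->; rewrite linearD. Qed.

Lemma iter_linearZ k (c : R[i]) x : iter k T (c *: x) = c *: iter k T x.
Proof. by elim: k => //= k ->; rewrite linearZ. Qed.

Context (p K C : R).
Hypothesis p12 : 1 <= p <= 2.
Hypothesis K0 : 0 < K.
Hypothesis C0 : 0 < C.
Hypothesis typeX : forall n (x : nat -> X),
  rmean n x (fun y => rnorm y `^ p) <= K * \sum_(i < n) rnorm (x i) `^ p.
Hypothesis ACB : forall n x,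
  \sum_(k < n) rnorm (iter k T x) <= C * n%:R * rnorm x.

Let p1 : 1 <= p. Proof. by case/andP: p12. Qed.
Let p0 : 0 < p. Proof. exact: lt_le_trans p1. Qed.

Let D := 2 * K `^ p^-1.

Let E0 : 0 <= 2 * C ^+ 2 * D.
Proof. by rewrite mulr_ge0 ?mulr_ge0 ?exprn_ge0 ?powR_ge0 ?(ltW C0). Qed.

(** Type bounds the p-th moment by K n; [powR_rmean_le] passes to the first moment, at the cost of
    the factor 2 in [D]. *)
Lemma rmean_unit_ball n (x : nat -> X) :
    (forall i, rnorm (x i) <= 1) ->
  rmean n x (@rnorm R X) <= D * n%:R `^ p^-1.
Proof.
move=> x1; have m0 := rmean_rnorm_ge0 n x.
have H : rmean n x (@rnorm R X) `^ p <= 2 `^ p * (K * n%:R).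
  apply: le_trans (powR_rmean_le n x p1 (@rnorm_ge0 R X)) _.
  rewrite ler_pM2l ?powR_gt0//; apply: le_trans (typeX _ _) _.
  rewrite ler_pM2l//.
  rewrite -[X in _ <= X%:R](card_ord n) -sumr_const ler_sum// => i _.
  by rewrite (le_trans (ge0_ler_powR (ltW p0) _ _ (x1 i)))
    ?nnegrE ?rnorm_ge0// powR1.
have -> : rmean n x (@rnorm R X) = (rmean n x (@rnorm R X) `^ p) `^ p^-1.
  by rewrite -powRrM mulfV ?gt_eqF// powRr1.
apply: (@le_trans _ _ ((2 `^ p * (K * n%:R)) `^ p^-1)).
  by rewrite ge0_ler_powR ?nnegrE ?invr_ge0 ?powR_ge0 ?mulr_ge0 ?powR_ge0
    ?(ltW K0) ?(ltW p0).
rewrite powRM ?powR_ge0 ?mulr_ge0 ?(ltW K0)// powRM ?(ltW K0)//.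
by rewrite -powRrM mulfV ?gt_eqF// powRr1// mulrA.
Qed.

(* Sum the tangent inequality 1/t >= 2/s - t/s^2 with s = C |x|. *)
Lemma sum_inv_orbit x i : iter i T x != 0 ->
  i.+1%:R / (C * rnorm x) <= \sum_(j < i.+1) (rnorm (iter j T x))^-1.
Proof.
move=> Tix.
have Tj j : (j < i.+1)%N -> 0 < rnorm (iter j T x).
  move=> ji; rewrite lt_def rnorm_ge0 andbT rnorm_eq0; apply: contra_neq Tix.
  by rewrite -(subnK (ji : (j <= i)%N)) iterD => ->; rewrite iter_linear0.
set s := C * rnorm x; have s0 : 0 < s by rewrite mulr_gt0// (Tj 0%N).
have := ACB i.+1 x; rewrite mulrAC -/s => H.
apply: (@le_trans _ _ (\sum_(j < i.+1) (2 / s - rnorm (iter j T x) / s ^+ 2))).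
  rewrite sumrB sumr_const card_ord -mulr_suml -mulr_natr.
  have : (\sum_(j < i.+1) rnorm (iter j T x)) / s ^+ 2 <= i.+1%:R / s.
    rewrite ler_pdivrMr ?exprn_gt0//.
    by rewrite (_ : _ * s ^+ 2 = s * i.+1%:R)//; field; rewrite gt_eqF.
  lra.
apply: ler_sum => j _; have tj := Tj j (ltn_ord j).
move: (rnorm _) tj => t t0.
rewrite -subr_ge0 (_ : _ - _ = (s - t) ^+ 2 / (t * s ^+ 2)).
  by rewrite divr_ge0 ?sqr_ge0// mulr_ge0 ?sqr_ge0 ?(ltW t0).
by field; rewrite !gt_eqF.
Qed.

Lemma rmean_upper_half n x : 0 < rnorm x ->
  rmean n (fun i => if (n <= 2 * i.+1)%N then iter i T x else 0)
    (@rnorm R X) <= 2 * C ^+ 2 * D * n%:R `^ p^-1 * rnorm x.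
Proof.
move=> x0; have [->|n0] := posnP n.
  by rewrite rmean0 rnorm0 (mulr_ge0 _ (ltW x0))// (mulr_ge0 E0) ?powR_ge0.
(* Since the inverse of 0 is 0, [y j] is 0 once the orbit has reached 0. *)
pose a j : R := (rnorm (iter j T x))^-1.
pose y j : X := (a j)%:C *: iter j T x.
have a0 j : 0 <= a j by rewrite invr_ge0 rnorm_ge0.
have y1 j : rnorm (y j) <= 1.
  rewrite rnormZ ger0_norm// /a.
  have [->|tn0] := eqVneq (rnorm (iter j T x)) 0; first by rewrite mulr0.
  by rewrite mulVf.
(* The terms of T^k y listed by the power of T they carry: with i = j + k, T^k maps a_j T^j x to
   a_(i-k) T^i x. The sign is thereby attached to i rather than to j, which leaves the mean
   unchanged. *)
pose v k i := if (i < k)%N then 0 else (a (i - k)%N)%:C *: iter i T x.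
have vk k : (k < n)%N -> rmean n (v k) (@rnorm R X) <=
    rmean n y (fun z => rnorm (iter k T z)).
  move=> kn; rewrite (@rmean_morph R X X n y (iter k T) (@rnorm R X)).
  - have {1}-> : n = ((n - k) + k)%N by rewrite subnK// ltnW.
    rewrite rmean_addn => [|i ik]; last by rewrite /v ik.
    apply: le_trans (rmean_rnorm_trunc _ (leq_subr k n)).
    rewrite le_eqVlt; apply/orP; left; apply/eqP; apply: eq_rmean_seq => j _.
    by rewrite /v ltnNge leq_addl /= addnK /y iter_linearZ addnC iterD.
  - exact: iter_linear0.
  - exact: iter_linearD.
have sumv : rmean n (fun i => \sum_(k < n) v k i) (@rnorm R X) <=
    C * n%:R * (D * n%:R `^ p^-1).
  apply: le_trans (rmean_rnorm_sum _ _ _) _.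
  apply: (@le_trans _ _ (\sum_(k < n) rmean n y (fun z => rnorm (iter k T z)))).
    by apply: ler_sum => k _; exact: vk.
  rewrite -(rmean_sum n y (index_enum 'I_n)
    (fun (k : 'I_n) z => rnorm (iter k T z))).
  (* Cesaro boundedness is applied to each realization of the random sum before averaging. *)
  apply: (@le_trans _ _ (C * n%:R * rmean n y (@rnorm R X))).
    by rewrite -rmeanZ; apply: le_rmean => z; exact: ACB.
  by rewrite ler_pM2l ?mulr_gt0 ?ltr0n// rmean_unit_ball.
pose s := C * rnorm x; have s0 : 0 < s by rewrite mulr_gt0.
(* The lower bound that [sum_inv_orbit] gives for b_i when n <= 2(i+1). Hence lam / b_i lies in
   [0, 1] and is an admissible contraction coefficient. *)
pose lam := n%:R / (2 * s).
have lam0 : 0 < lam by rewrite divr_gt0 ?mulr_gt0 ?ltr0n.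
have vsum i : (i < n)%N ->
    \sum_(k < n) v k i = (\sum_(j < i.+1) a j)%:C *: iter i T x.
  move=> ni; rewrite -(subnK ni) addnC big_split_ord /=.
  rewrite [X in _ + X]big1 ?addr0 => [|k _]; last first.
    by rewrite /v ltnS leq_addr.
  rewrite (reindex_inj rev_ord_inj) /= rmorph_sum scaler_suml.
  apply: eq_bigr => j _; rewrite /v subSS ltnNge leq_subr /=.
  by rewrite subKn// -ltnS.
apply: (@le_trans _ _ (rmean n
    (fun i => lam^-1%:C *: \sum_(k < n) v k i) (@rnorm R X))).
  apply: rmean_rnorm_contraction => i ni; rewrite vsum// scalerA -rmorphM.
  case: ifP => [ni2|_]; last by exists 0; [lra|rewrite scale0r].
  have [->|Tix] := eqVneq (iter i T x) 0.
    by exists 0; [lra|rewrite !scaler0].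
  set b := \sum_(j < i.+1) a j.
  have lamb : lam <= b.
    apply: le_trans (sum_inv_orbit Tix).
    rewrite /lam invfM mulrA -/s ler_pM2r ?invr_gt0// ler_pdivrMr//.
    by rewrite mulrC -natrM ler_nat.
  have b0 : 0 < b by rewrite (lt_le_trans lam0).
  exists (lam / b).
    rewrite ler_pdivrMr// mul1r lamb andbT (@le_trans _ _ 0)//.
    by rewrite divr_ge0 ?ltW.
  rewrite scalerA -rmorphM (_ : lam / b * (lam^-1 * b) = 1) ?scale1r//.
  by field; rewrite !gt_eqF.
rewrite rmean_rnormZ gtr0_norm ?invr_gt0// ler_pdivrMl//.
apply: le_trans sumv _; rewrite le_eqVlt; apply/orP; left; apply/eqP.
by rewrite /lam /s; field; rewrite !gt_eqF.
Qed.

(** Strong induction on the length. Writing E for the constant of the upper half, the factor 4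
    closes the induction: the lower half contributes 3/4 of 4E and the upper half E. *)
Lemma rmean_orbit_le n x :
  rmean n (fun i => iter i T x) (@rnorm R X) <=
  4 * (2 * C ^+ 2 * D) * n%:R `^ p^-1 * rnorm x.
Proof.
have := rnorm_ge0 x; rewrite le_eqVlt => /predU1P[x0|x0].
  have /eqP -> : x == 0 by rewrite -rnorm_eq0 -x0.
  rewrite rnorm0 mulr0 (@rmean_tail0 _ _ 0)// => [|i _]; last by rewrite iter_linear0.
  by rewrite rmean0 rnorm0.
have := E0; set E := 2 * C ^+ 2 * D => E0'.
elim/ltn_ind: n => -[_|n IH].
  by rewrite rmean0 rnorm0 (mulr_ge0 _ (ltW x0))//
    (mulr_ge0 (mulr_ge0 (ler0n R 4) E0')) ?powR_ge0.
(* Rounded down, so that [m] is smaller than the length; indices from [m] on still satisfy [P]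
   thanks to the successor in it. *)
set m := (n.+1)./2.
have mn : (m < n.+1)%N by rewrite /m ltn_half_double -addnn addSn ltnS leq_addl.
pose P i := (n.+1 <= 2 * i.+1)%N.
have Pm i : (m <= i < n.+1)%N -> P i.
  move=> /andP[mi _]; move: mi; rewrite /m leq_half_double => /leq_trans.
  by apply; rewrite mul2n doubleS.
have H : rmean n.+1 (fun i => iter i T x) (@rnorm R X) <=
    rmean m (fun i => iter i T x) (@rnorm R X) + E * n.+1%:R `^ p^-1 * rnorm x.
  apply: le_trans (lerD (rmean_rnorm_restrict _ _ (fun i => ~~ P i))
    (rmean_upper_half n.+1 x0)).
  rewrite -(@rmean_tail0 _ _ m n.+1)//; last first.
  - by move=> i /Pm ->.
  - exact: ltnW.
  rewrite (_ : (fun i => iter i T x) = fun i =>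
      (if ~~ P i then iter i T x else 0) + (if P i then iter i T x else 0)).
    by apply: rmean_le_add => y z; exact: rnormD.
  by apply/funext => i; case: (P i); rewrite ?add0r ?addr0.
apply: (le_trans H); apply: (le_trans (lerD (IH m mn) (lexx _))).
rewrite -mulrDl ler_pM2r//.
have pV : 0 < p^-1 by rewrite invr_gt0.
(* As p <= 2, halving the length gains 2^(-1/p) <= 2^(-1/2) <= 3/4. *)
have mle : m%:R `^ p^-1 <= 3 / 4 * n.+1%:R `^ p^-1.
  apply: (@le_trans _ _ ((2^-1 * n.+1%:R) `^ p^-1)).
    rewrite ge0_ler_powR ?nnegrE ?mulr_ge0 ?(ltW pV)//.
    by rewrite ler_pdivlMl// -natrM ler_nat mul2n -geq_half_double.
  rewrite powRM// ler_wpM2r ?powR_ge0//.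
  apply: (@le_trans _ _ (2^-1 `^ 2^-1)).
    apply: ger_powR; first by rewrite invr_gt0 invf_le1 ?ltr0n ?ler1n.
    by rewrite lef_pV2 ?posrE//; case/andP: p12.
  rewrite powR12_sqrt// -(@ler_pXn2r _ 2)// ?nnegrE ?sqrtr_ge0//.
  by rewrite sqr_sqrtr//; lra.
have : 0 <= E * n.+1%:R `^ p^-1.
  exact: mulr_ge0 E0' (powR_ge0 _ _).
have := ler_wpM2l (mulr_ge0 (ler0n R 4) E0') mle.
lra.
Qed.

End orbit.

(** * Block decomposition and operator norms *)

Lemma signed_sum_exchange (V : zmodType) m n (x : nat -> nat -> V)
    (w : {ffun 'I_m -> bool}) (w' : {ffun 'I_n -> bool}) :
  signed_sum (fun l => signed_sum (x l) w') w =
  signed_sum (fun i => signed_sum (x^~ i) w) w'.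
Proof.
have sum_if (b : bool) (I : finType) (F : I -> V) :
    (if b then \sum_i F i else - \sum_i F i) =
    \sum_i (if b then F i else - F i).
  by case: b => //; rewrite sumrN.
rewrite /signed_sum; under eq_bigr do rewrite sum_if.
under [RHS]eq_bigr do rewrite sum_if.
rewrite exchange_big; apply: eq_bigr => i _; apply: eq_bigr => l _.
by do 2 case: ifP.
Qed.

Section blocks.
Context {R : realType} {X : normedModType R[i]} (q K : R).
Hypothesis q0 : 0 < q.
Hypothesis K0 : 0 < K.
Hypothesis cotypeX : forall n (x : nat -> X),
  \sum_(i < n) rnorm (x i) `^ q <= K * rmean n x (fun y => rnorm y `^ q).

(* Cotype is applied, for fixed signs [w], to the block sums, with fresh signs
   [w']; multiplying whole blocks by signs only contracts the full sum. *)
Lemma cotype_blocks (H : R) :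
    (forall n (x : nat -> X),
      rmean n x (fun y => rnorm y `^ q) <= H * rmean n x (@rnorm R X) `^ q) ->
    0 <= H -> forall n m (x : nat -> X) (lab : nat -> nat),
  \sum_(l < m) rmean n (fun i => if lab i == l then x i else 0)
    (fun y => rnorm y `^ q) <= K * H * rmean n x (@rnorm R X) `^ q.
Proof.
move=> KH H0 n m x lab.
pose xl l i := if lab i == l then x i else 0.
have r0 : 0 <= 2^-1 ^+ n :> R by rewrite exprn_ge0.
apply: (@le_trans _ _ (2^-1 ^+ n * \sum_(w : {ffun 'I_n -> bool})
    K * rmean m (fun l => signed_sum (xl l) w) (fun y => rnorm y `^ q))).
  rewrite /rmean -mulr_sumr ler_wpM2l// exchange_big ler_sum// => w _.
  exact: (cotypeX m (fun l => signed_sum (xl l) w)).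
rewrite -mulr_sumr mulrCA -mulrA ler_pM2l//.
apply: (@le_trans _ _ (2^-1 ^+ m * \sum_(w' : {ffun 'I_m -> bool})
    rmean n (fun i => signed_sum (xl^~ i) w') (fun y => rnorm y `^ q))).
  rewrite /rmean -!mulr_sumr mulrCA exchange_big /=.
  rewrite le_eqVlt; apply/orP; left; apply/eqP; congr (_ * (_ * _)).
  by apply: eq_bigr => w' _; apply: eq_bigr => w _; rewrite signed_sum_exchange.
rewrite -[leRHS](rmean_cst m x) /rmean ler_wpM2l ?exprn_ge0// ler_sum// => w' _.
apply: le_trans (KH _ _) _; rewrite ler_wpM2l// ge0_ler_powR ?(ltW q0)//.
- by rewrite nnegrE rmean_rnorm_ge0.
- by rewrite nnegrE rmean_rnorm_ge0.
apply: rmean_rnorm_contraction => i _; rewrite /signed_sum /xl.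
have [im|mi] := ltnP (lab i) m; last first.
  exists 0; first lra.
  rewrite scale0r big1// => l _; rewrite gtn_eqF ?(leq_trans (ltn_ord l))//.
  by rewrite oppr0 if_same.
rewrite (bigD1 (Ordinal im))//= eqxx big1 ?addr0 => [|l ]; last first.
  rewrite -val_eqE eq_sym /= => /negbTE ->.
  by rewrite oppr0 if_same.
case: ifP => _; first by exists 1; [lra|rewrite scale1r].
by exists (-1); [lra|rewrite rmorphN scaleNr scale1r].
Qed.

End blocks.

Section orbit_blocks.
Context {R : realType} {X : normedModType R[i]} (T : {linear X -> X}) (C : R).
Hypothesis ACB : forall n x,
  \sum_(k < n) rnorm (iter k T x) <= C * n%:R * rnorm x.

(** For each of the 2^l values k in [2^l, 2^(l+1)), the index n - k lies in block l and T^k carries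
    its term to T^n x, so the mean of |T^k z| is at least |T^n x|. Cesaro boundedness over 2^(l+1)
    steps bounds the sum of these means; the ratio of the two counts is the factor 2. *)
Lemma rnorm_iter_le_block n l (x : X) : (2 ^ l.+1 <= n)%N ->
  rnorm (iter n T x) <=
  2 * C * rmean n (fun i => if trunc_log 2 (n - i) == l then iter i T x else 0)
    (@rnorm R X).
Proof.
move=> ln; set z := fun i => _; set m := rmean n z _.
have term k : (2 ^ l <= k < 2 ^ l.+1)%N ->
    rnorm (iter n T x) <= rmean n z (fun y => rnorm (iter k T y)).
  move=> kl; have [lk kl1] := andP kl.
  have k0 : (0 < k)%N by rewrite (leq_trans _ lk)// expn_gt0.
  have kn : (k <= n)%N by rewrite (leq_trans (ltnW kl1)).
  rewrite (@rmean_morph R X X n z (iter k T) (@rnorm R X)).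
  - have nk : (n - k < n)%N by rewrite ltn_subrL k0 (leq_trans k0).
    apply: le_trans (rnorm_le_rmean (iter k T \o z) nk).
    by rewrite /= /z subKn// (trunc_log_eq _ kl)// eqxx -iterD subnKC.
  - exact: iter_linear0.
  - exact: iter_linearD.
have p0 : 0 < (2 ^ l)%:R :> R by rewrite ltr0n expn_gt0.
rewrite -(ler_pM2l p0).
have -> : (2 ^ l)%:R * (2 * C * m) = C * (2 ^ l.+1)%:R * m.
  by rewrite expnS natrM; ring.
rewrite /m -rmeanZ.
apply: le_trans (le_rmean _ _ (fun y => ACB (2 ^ l.+1) y)).
rewrite (rmean_sum n z (index_enum 'I_(2 ^ l.+1))
  (fun (k : 'I_(2 ^ l.+1)) y => rnorm (iter k T y))).
rewrite -(big_mkord xpredT (fun k => rmean n z (fun y => rnorm (iter k T y)))).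
have l2 : (2 ^ l <= 2 ^ l.+1)%N by rewrite leq_exp2l.
rewrite (big_cat_nat (leq0n _) l2) /= -[leLHS]add0r lerD//.
  by rewrite sumr_ge0// => k _; apply: rmean_ge0 => y; exact: rnorm_ge0.
rewrite mulr_natl.
have -> : rnorm (iter n T x) *+ (2 ^ l) =
    \sum_(2 ^ l <= k < 2 ^ l.+1) rnorm (iter n T x).
  by rewrite sumr_const_nat expnS mul2n -addnn addnK.
by apply: ler_sum_nat => k; exact: term.
Qed.

End orbit_blocks.

(** With L the truncated logarithm, ln n <= (L + 1) ln 2 <= L + 1 <= 2L, the last step because L >=
    1. *)
Lemma ln_le_trunc_log (R : realType) n : (1 < n)%N ->
  ln n%:R <= 2 * (trunc_log 2 n)%:R :> R.
Proof.
move=> n1; set L := trunc_log 2 n.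
have L1 : (1 <= L)%N by rewrite trunc_log_gt0 n1.
have nL : (n < 2 ^ L.+1)%N by exact: trunc_log_ltn.
apply: (@le_trans _ _ (ln ((2 : R) ^+ L.+1))).
  rewrite ler_ln ?posrE ?ltr0n ?exprn_gt0 ?(ltnW n1)//.
  by rewrite -natrX ler_nat ltnW.
rewrite lnXn// -[leLHS]mulr_natr.
have l2 : ln 2 <= 1 :> R.
  by rewrite (_ : 2 = 1 + 1)// le_ln1Dx// ltrN10.
have L1' : 1 <= L%:R :> R by rewrite ler1n.
apply: (@le_trans _ _ (1 * L.+1%:R)); first by rewrite ler_wpM2r.
rewrite -(natr1 L); lra.
Qed.

Section opnorm.
Context {R : realType} {X : normedModType R[i]}.

Lemma opnorm_bound (S : X -> X) (B : R) : 0 <= B ->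
  (forall x, rnorm (S x) <= B * rnorm x) -> 0 <= opnorm S <= B.
Proof.
move=> B0 SB; set A := [set rnorm (S x) | x in [set x | rnorm x <= 1]].
have ubA : ubound A B.
  by move=> _ [x /= x1 <-]; rewrite (le_trans (SB x))// ler_piMr.
have A0 : A (rnorm (S 0)) by exists 0 => //=; rewrite rnorm0.
apply/andP; split; last by apply: ge_sup => //; exists (rnorm (S 0)).
rewrite (le_trans (rnorm_ge0 (S 0)))//.
by apply: ub_le_sup => //; exists B.
Qed.

Lemma opnorm_bigO (S : nat -> X -> X) (g : nat -> R) (B : R) :
    0 <= B -> (forall n, 0 <= g n) ->
    (forall n x, (1 < n)%N -> rnorm (S n x) <= B * g n * rnorm x) ->
  (fun n => opnorm (S n)) =O_\oo g.
Proof.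
(* [B + 1] is positive even if [B] is 0. The threshold 2 matches the range where the logarithm of n
   is positive. *)
move=> B0 g0 SB; apply/eqO_exP; exists (B + 1); first by rewrite ltr_wpDl.
exists 2%N => // n /= n2.
have /andP[S0 SnB] : 0 <= opnorm (S n) <= B * g n.
  by apply: opnorm_bound => [|x]; [rewrite mulr_ge0|exact: SB].
rewrite !ger0_norm//; apply: (le_trans SnB).
by rewrite ler_wpM2r// lerDl.
Qed.

End opnorm.

(** * From the orbit mean to the growth of powers *)

Section power_bounds.
Context {R : realType} {X : normedModType R[i]} (T : {linear X -> X}).
Context (p A C : R).
Hypothesis p1 : 1 <= p.
Hypothesis A0 : 0 < A.
Hypothesis C0 : 0 < C.
Hypothesis ACB : forall n x,
  \sum_(k < n) rnorm (iter k T x) <= C * n%:R * rnorm x.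
Hypothesis orbit_mean : forall n x,
  rmean n (fun i => iter i T x) (@rnorm R X) <= A * n%:R `^ p^-1 * rnorm x.

Let p0 : 0 < p. Proof. exact: lt_le_trans p1. Qed.

(** T^n x is the last term of the orbit sum of length n + 1, and (n + 1)^(1/p) <= (2n)^(1/p) <= 2
    n^(1/p). *)
Lemma rnorm_iter_le n x : (0 < n)%N ->
  rnorm (iter n T x) <= 2 * A * n%:R `^ p^-1 * rnorm x.
Proof.
move=> n0.
apply: le_trans (rnorm_le_rmean (fun i => iter i T x) (ltnSn n)) _.
apply: le_trans (orbit_mean _ _) _; rewrite ler_wpM2r ?rnorm_ge0//.
rewrite (mulrC 2) -mulrA ler_pM2l//.
apply: (@le_trans _ _ ((2 * n%:R) `^ p^-1)).
  rewrite ge0_ler_powR ?nnegrE ?invr_ge0 ?(ltW p0) ?mulr_ge0//.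
  by rewrite -natrM ler_nat mul2n -addnn -addn1 leq_add2l.
rewrite powRM// ler_wpM2r ?powR_ge0// ler1_powR ?ler1n//.
by rewrite invf_le1.
Qed.

Lemma orbit_moment_le (r H : R) n x : 0 < r -> 0 <= H ->
    (forall n (x : nat -> X),
      rmean n x (fun y => rnorm y `^ r) <= H * rmean n x (@rnorm R X) `^ r) ->
  rmean n (fun i => iter i T x) (fun y => rnorm y `^ r) <=
  H * A `^ r * n%:R `^ (r / p) * rnorm x `^ r.
Proof.
move=> r0 H0 KH; apply: le_trans (KH _ _) _.
rewrite -!mulrA ler_wpM2l// [r / p]mulrC powRrM -!powRM ?mulr_ge0 ?powR_ge0
  ?rnorm_ge0 ?(ltW A0)//.
rewrite ge0_ler_powR ?nnegrE ?(ltW r0) ?rmean_rnorm_ge0//.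
  by rewrite !mulr_ge0 ?powR_ge0 ?rnorm_ge0 ?(ltW A0).
by rewrite mulrA.
Qed.

Lemma rnorm_iter_log_le (q K H : R) n x : 1 <= q -> 0 < K -> 0 <= H ->
    (forall n (x : nat -> X),
      \sum_(i < n) rnorm (x i) `^ q <= K * rmean n x (fun y => rnorm y `^ q)) ->
    (forall n (x : nat -> X),
      rmean n x (fun y => rnorm y `^ q) <= H * rmean n x (@rnorm R X) `^ q) ->
    (1 < n)%N ->
  rnorm (iter n T x) <= 4 * C * A * (2 * (K * H)) `^ q^-1 *
    (n%:R `^ p^-1 / ln n%:R `^ q^-1) * rnorm x.
Proof.
move=> q1 K0 H0 cotypeX KH n1; have q0 : 0 < q := lt_le_trans ltr01 q1.
set t := rnorm _; have t0 : 0 <= t by exact: rnorm_ge0.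
(* The blocks l < L are those with 2^(l+1) <= n, as [rnorm_iter_le_block] requires. *)
set L := trunc_log 2 n.
have lnn0 : 0 < ln n%:R :> R by rewrite ln_gt0// ltr1n.
pose W := 4 * C * A * n%:R `^ p^-1 * rnorm x.
have M0 : 0 <= K * H by rewrite mulr_ge0// ltW.
have W0 : 0 <= W.
  by rewrite !mulr_ge0 ?powR_ge0 ?rnorm_ge0 ?(ltW C0) ?(ltW A0).
pose z l i := if trunc_log 2 (n - i) == l then iter i T x else 0.
(* In 4C, one factor 2 comes from the block estimate and the other from [powR_rmean_le]. *)
have tz (l : 'I_L) :
    t `^ q <= (4 * C) `^ q * rmean n (z l) (fun y => rnorm y `^ q).
  have l2n : (2 ^ l.+1 <= n)%N.
    apply: leq_trans (trunc_logP (isT : 1 < 2)%N (ltnW n1)).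
    by rewrite leq_exp2l.
  have C2 : 0 <= 2 * C by rewrite mulr_ge0// ltW.
  have r0 := rmean_rnorm_ge0 n (z l).
  apply: (@le_trans _ _ ((2 * C * rmean n (z l) (@rnorm R X)) `^ q)).
    apply: ge0_ler_powR; rewrite ?nnegrE ?(ltW q0)//; first exact: mulr_ge0.
    exact: (rnorm_iter_le_block ACB).
  rewrite powRM//.
  rewrite (_ : 4 * C = 2 * C * 2); last by ring.
  rewrite [X in _ <= X * _]powRM// -mulrA.
  by rewrite ler_wpM2l ?powR_ge0// powR_rmean_le//; exact: rnorm_ge0.
(* Sum the L equal lower bounds; [cotype_blocks] bounds the total by the full orbit mean. *)
have Lt : L%:R * t `^ q <= K * H * W `^ q.
  rewrite mulr_natl -[X in _ *+ X](card_ord L) -sumr_const.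
  apply: (le_trans (ler_sum _ (fun l _ => tz l))).
  rewrite -mulr_sumr.
  apply: (@le_trans _ _ ((4 * C) `^ q * (K * H *
      rmean n (fun i => iter i T x) (@rnorm R X) `^ q))).
    rewrite ler_wpM2l ?powR_ge0//.
    exact: (@cotype_blocks _ _ _ _ q0 K0 cotypeX _ KH H0 n L
      (fun i => iter i T x) (fun i => trunc_log 2 (n - i))).
  have C4 : 0 <= 4 * C by rewrite mulr_ge0// ltW.
  have r0 := rmean_rnorm_ge0 n (fun i => iter i T x).
  rewrite mulrCA ler_wpM2l// -powRM//.
  apply: ge0_ler_powR; rewrite ?nnegrE ?(ltW q0)//; first exact: mulr_ge0.
  rewrite (_ : W = 4 * C * (A * n%:R `^ p^-1 * rnorm x)); last by rewrite /W; ring.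
  by rewrite ler_pM2l ?mulr_gt0.
have lnt : t `^ q * ln n%:R <= 2 * (K * H) * W `^ q.
  apply: (@le_trans _ _ (t `^ q * (2 * L%:R))).
    by rewrite ler_wpM2l ?powR_ge0// ln_le_trunc_log.
  by rewrite mulrC -!mulrA ler_pM2l// mulrA.
suff : t * ln n%:R `^ q^-1 <= (2 * (K * H)) `^ q^-1 * W.
  rewrite -ler_pdivlMr ?powR_gt0// => /le_trans; apply.
  by rewrite le_eqVlt; apply/orP; left; apply/eqP; rewrite /W; ring.
have rootK s : 0 <= s -> (s `^ q) `^ q^-1 = s.
  by move=> s0; rewrite -powRrM mulfV ?gt_eqF// powRr1.
rewrite -[X in X * _ <= _](rootK _ t0) -[X in _ <= _ * X](rootK _ W0).
have M2 : 0 <= 2 * (K * H) by rewrite mulr_ge0.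
rewrite -!powRM ?powR_ge0 ?(ltW lnn0)//.
apply: ge0_ler_powR; rewrite ?nnegrE ?invr_ge0 ?(ltW q0)//.
- exact: mulr_ge0 (powR_ge0 _ _) (ltW lnn0).
- exact: mulr_ge0 M2 (powR_ge0 _ _).
Qed.

End power_bounds.

Unset Implicit Arguments.

Theorem theorem2p3 (R : realType) (p : R) (X : completeNormedModType R[i])
    (T : {linear X -> X}) (hp : 1 <= p <= 2) (Xp : of_type X p)
    (Tbnd : bounded_operator T) (TACB : absolutely_Cesaro_bounded T) :
  [/\ (fun n => opnorm (iter n T)) =O_\oo (fun n => n%:R `^ p^-1),
      exists2 C : R, 0 < C &
        forall (x : X) (d : measure_display) (Omega : measurableType d)
          (P : probability Omega R) (e : nat -> {RV P >-> R}) (n : nat),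
        iid_rademacher e -> (0 < n)%N ->
        ('E_P[fun w =>
           (rnorm (\sum_(k < n) (e k w)%:C *: iter k T x) `^ p)%R] <=
         (C * n%:R * rnorm x `^ p)%R%:E)%E
    & forall q : R, 2 <= q -> of_cotype X q ->
        (fun n => opnorm (iter n T)) =O_\oo
          (fun n => n%:R `^ p^-1 / ln n%:R `^ q^-1) /\
        (exists2 C : R, 0 < C &
           forall (x : X) (n : nat), (0 < n)%N ->
           \sum_(k < n) rnorm (iter k T x) `^ q <=
           C * n%:R `^ (q / p) * rnorm x `^ q)].
Proof.
have [p1 p2] := andP hp; have p0 : 0 < p := lt_le_trans ltr01 p1.
have [K K0 typeX] := of_type_rmean (lt0r_neq0 p0) Xp.
have [C C0 ACB] := Cesaro_sum_le TACB.
pose A := 4 * (2 * C ^+ 2 * (2 * K `^ p^-1)).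
have A0 : 0 < A by rewrite !mulr_gt0 ?exprn_gt0 ?powR_gt0.
have orbit_mean n x : rmean n (fun i => iter i T x) (@rnorm R X) <=
    A * n%:R `^ p^-1 * rnorm x.
  exact: (rmean_orbit_le hp K0 C0 typeX ACB).
split.
- apply: (@opnorm_bigO _ _ _ _ (2 * A)).
  + by rewrite mulr_ge0// ltW.
  + by move=> n; exact: powR_ge0.
  + by move=> n x n1; apply: (rnorm_iter_le p1 A0 orbit_mean); exact: ltnW.
- have [H H0 KH] := Kahane p0.
  exists (H * A `^ p); first by rewrite mulr_gt0 ?powR_gt0.
  move=> x d Omega P e n iid _.
  apply: le_trans (expectation_rademacher_le iid n (fun k => iter k T x)
    (fun y => powR_ge0 (rnorm y) p)) _.
  rewrite lee_fin.
  have := orbit_moment_le A0 orbit_mean n x p0 (ltW H0) (KH X).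
  (* At r = p the exponent r / p is 1, which gives the linear growth in n. *)
  by rewrite mulfV ?gt_eqF// powRr1.
- move=> q q2 Xq; have q1 : 1 <= q by rewrite (le_trans _ q2)// ler1n.
  have q0 : 0 < q := lt_le_trans ltr01 q1.
  have [K' K'0 cotypeX] := of_cotype_rmean Xq.
  have [H H0 KH] := Kahane q0.
  split.
    apply: (@opnorm_bigO _ _ _ _ (4 * C * A * (2 * (K' * H)) `^ q^-1)).
    + by rewrite !mulr_ge0 ?powR_ge0 ?(ltW C0) ?(ltW A0).
    + by move=> n; rewrite divr_ge0 ?powR_ge0.
    + move=> n x n1.
      exact: (rnorm_iter_log_le A0 C0 ACB orbit_mean x q1 K'0 (ltW H0) cotypeX (KH X)).
  exists (K' * (H * A `^ q)); first by rewrite !mulr_gt0 ?powR_gt0.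
  (* Cotype is applied to the orbit itself, and Kahane's inequality bounds the resulting q-th
     moment. *)
  move=> x n _; apply: le_trans (cotypeX n (fun k => iter k T x)) _.
  rewrite -!mulrA ler_pM2l//.
  by have := orbit_moment_le A0 orbit_mean n x q0 (ltW H0) (KH X); rewrite -!mulrA.
Qed.
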